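(* Let $n\ge 1$ and $M=(\mathbb{R}^+)^n$. Let $M_t$ denote $M$ equipped with the flat torsion-free affine connection for which the logarithmic coordinates $t_i=\log x_i$ are affine, and let $M_x$ denote $M$ equipped with the flat torsion-free affine connection for which the original coordinates $x_i$ are affine. Then $M_t$ is geodesically complete with respect to its affine connection, whereas $M_x$ is geodesically incomplete with respect to its affine connection.
   Context: $\mathbb{R}^+$ denotes the positive reals. Coordinates are affine for a connection if all connection coefficients $\Gamma^i_{jk}$ vanish identically in these coordinates. A geodesic of an affine connection is a curve satisfying $\ddot\gamma^i+\Gamma^i_{jk}\dot\gamma^j\dot\gamma^k=0$; the connection is geodesically complete if every maximal geodesic is defined for all parameter values $\lambda\in\mathbb{R}$, and incomplete otherwise. *)

(* Defs.v *)
From HB Require Import structures.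
From mathcomp Require Import all_boot all_order all_algebra.
From mathcomp Require Import all_classical all_reals all_analysis.

Set Implicit Arguments.
Unset Strict Implicit.
Unset Printing Implicit Defensive.

Import Order.TTheory GRing.Theory Num.Theory.
Import numFieldNormedType.Exports.

Local Open Scope classical_set_scope.
Local Open Scope ring_scope.

Section SmoothCalculus.
Context {R : realType} {n : nat}.
Implicit Types (U : set 'rV[R]_n) (p : 'rV[R]_n).

Definition scalar_field := 'rV[R]_n -> R.
Definition vector_field := 'rV[R]_n -> 'rV[R]_n.

Definition pderiv (j : 'I_n) (f : scalar_field) : scalar_field :=
  fun p => 'D_(delta_mx 0 j) f p.

(* Class C^k on an open set U: every partial derivative of order at most k
   exists and is continuous at each point of U. *)
Fixpoint Ck_on (k : nat) U (f : scalar_field) : Prop :=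
  (forall p, U p -> {for p, continuous f}) /\
  (if k is k'.+1 then
     forall j : 'I_n,
       (forall p, U p -> derivable f p (delta_mx 0 j)) /\
       Ck_on k' U (pderiv j f)
   else True).

Definition smooth_on U (f : scalar_field) : Prop := forall k, Ck_on k U f.

Definition smooth_field_on U (X : vector_field) : Prop :=
  forall i : 'I_n, smooth_on U (fun p => X p 0 i).

(* The derivation X(f) = X^j d_j f attached to a vector field. *)
Definition act (X : vector_field) (f : scalar_field) : scalar_field :=
  fun p => \sum_(j < n) X p 0 j * pderiv j f p.

Definition act_field (X Y : vector_field) : vector_field :=
  fun p => \row_i act X (fun q => Y q 0 i) p.

Definition lie_bracket (X Y : vector_field) : vector_field :=
  fun p => act_field X Y p - act_field Y X p.

(* An affine connection on the open set U, as a covariant derivative on smooth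
   vector fields. Fields on U are represented by total functions, of which only
   the values on U are meaningful; [connection_ext] expresses this. *)
Record connection U := Connection {
  nabla :> vector_field -> vector_field -> vector_field;
  connection_smooth : forall X Y,
    smooth_field_on U X -> smooth_field_on U Y ->
    smooth_field_on U (nabla X Y);
  connection_ext : forall X X' Y Y',
    smooth_field_on U X -> smooth_field_on U X' ->
    smooth_field_on U Y -> smooth_field_on U Y' ->
    (forall p, U p -> X p = X' p) -> (forall p, U p -> Y p = Y' p) ->
    forall p, U p -> nabla X Y p = nabla X' Y' p;
  connection_linear : forall f X X' Y,
    smooth_on U f -> smooth_field_on U X -> smooth_field_on U X' ->
    smooth_field_on U Y ->
    forall p, U p ->
      nabla (fun q => f q *: X q + X' q) Y p =
      f p *: nabla X Y p + nabla X' Y p;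
  connection_additive : forall X Y Y',
    smooth_field_on U X -> smooth_field_on U Y -> smooth_field_on U Y' ->
    forall p, U p ->
      nabla X (fun q => Y q + Y' q) p = nabla X Y p + nabla X Y' p;
  connection_leibniz : forall f X Y,
    smooth_on U f -> smooth_field_on U X -> smooth_field_on U Y ->
    forall p, U p ->
      nabla X (fun q => f q *: Y q) p =
      act X f p *: Y p + f p *: nabla X Y p
}.

Definition torsion_free U (D : connection U) : Prop :=
  forall X Y, smooth_field_on U X -> smooth_field_on U Y ->
  forall p, U p -> D X Y p - D Y X p = lie_bracket X Y p.

Definition flat U (D : connection U) : Prop :=
  forall X Y Z,
    smooth_field_on U X -> smooth_field_on U Y -> smooth_field_on U Z ->
  forall p, U p ->
    D X (D Y Z) p - D Y (D X Z) p - D (lie_bracket X Y) Z p = 0.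

(* Below, phi is a global coordinate system y = phi x on U. Row convention:
   v *m 'J phi p is the image of v under the differential of phi at p. *)

(* The coordinate field d/dy^j, i.e. the field that the differential of phi
   maps to the j-th basis vector. *)
Definition coord_field (phi : vector_field) (j : 'I_n) : vector_field :=
  fun p => row j (invmx ('J phi p)).

(* The defining relation of the coefficients of D in the coordinates phi is
   D_{d/dy^j} (d/dy^k) = Gamma^i_{jk} d/dy^i. *)
Definition connection_coef (phi : vector_field) U (D : connection U)
    (i j k : 'I_n) : scalar_field :=
  fun p => (D (coord_field phi j) (coord_field phi k) p *m 'J phi p) 0 i.

Definition affine_coordinates (phi : vector_field) U (D : connection U) : Prop :=
  forall i j k p, U p -> connection_coef phi D i j k p = 0.

(* A geodesic c of D with domain the open interval I. The equation is written
   in the standard coordinates of R^n restricted to U. *)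
Definition geodesic U (D : connection U) (I : set R) (c : R -> 'rV[R]_n) : Prop :=
  let x (i : 'I_n) := fun s : R => c s 0 i in
  let x' (i : 'I_n) := derive1 (x i) in
  [/\ open I, is_interval I, I !=set0, (forall s, I s -> U (c s)) &
      forall s, I s -> forall i : 'I_n,
        [/\ derivable (x i) s 1, derivable (x' i) s 1 &
            derive1 (x' i) s +
            \sum_(j < n) \sum_(k < n)
              connection_coef id D i j k (c s) * x' j s * x' k s = 0]].

Definition maximal_geodesic U (D : connection U) (I : set R)
    (c : R -> 'rV[R]_n) : Prop :=
  geodesic D I c /\
  forall J d, geodesic D J d -> I `<=` J -> (forall s, I s -> d s = c s) ->
  J = I.

Definition geodesically_complete U (D : connection U) : Prop :=
  forall I c, maximal_geodesic D I c -> I = setT.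

Definition positive_orthant : set 'rV[R]_n :=
  [set x | forall i, 0 < x 0 i].

Definition log_coordinates : vector_field := fun x => \row_i ln (x 0 i).

End SmoothCalculus.

Arguments positive_orthant : clear implicits.
Arguments log_coordinates : clear implicits.

(* Main.v *)
Require Import Defs.
From HB Require Import structures.
From mathcomp Require Import all_boot all_order all_algebra.
From mathcomp Require Import all_classical all_reals all_analysis.
From mathcomp Require Import ring lra.

Set Implicit Arguments.
Unset Strict Implicit.
Unset Printing Implicit Defensive.

Import Order.TTheory GRing.Theory Num.Theory.
Import numFieldNormedType.Exports.

Local Open Scope classical_set_scope.
Local Open Scope ring_scope.

(** Rewriting D_{x_j d_j} (x_k d_k) = 0 in the standard frame gives
    Gamma^i_{jk} = - [i = j = k] / x_i for the log-affine connection, so its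
    geodesics solve x_i'' = x_i'^2 / x_i, i.e. x_i = b_i exp (a_i s), and these
    extend to the whole line inside the orthant.  For the id-affine connection
    every geodesic has affine components; s |-> (1 + s, ..., 1 + s) on
    ]-1, +oo[ is maximal, since an extension would still be 1 + s, which is
    not positive at s <= -1. *)

(** * Open sets and smoothness of simple fields *)

Lemma near_in_set (T : topologicalType) (U : set T) (p : T) :
  open U -> U p -> \forall q \near p, U q.
Proof. by move=> oU Up; apply: open_nbhs_nbhs; split. Qed.

Lemma open_positive_orthant (R : realType) (n : nat) :
  open (positive_orthant R n).
Proof.
rewrite openE => p p_gt0.
suff : \forall q \near nbhs p, forall i, 0 < (q : 'rV[R]_n) 0 i by [].
apply: filter_forall => i.
apply: (@coord_continuous R 1 n 0 i p [set x : R | 0 < x]).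
by apply: (near_in_set (U := [set x : R | 0 < x])) (p_gt0 i); exact: open_gt.
Qed.

Lemma continuous_near_ext (T S : topologicalType) (f g : T -> S) (p : T) :
  (\near p, f p = g p) -> {for p, continuous f} -> {for p, continuous g}.
Proof.
move=> fg cf; have fgp : f p = g p by exact: nbhs_singleton fg.
rewrite /prop_for /continuous_at -fgp.
by apply: cvg_trans cf; exact: near_eq_cvg.
Qed.

(** Since [U] is open, equality on [U] is equality near each of its points, so the partial
    derivatives agree on [U] as well and the induction on the order goes through. *)
Lemma Ck_on_ext (R : realType) (n k : nat) (U : set 'rV[R]_n)
    (f g : scalar_field) :
  open U -> (forall p, U p -> f p = g p) -> Ck_on k U f -> Ck_on k U g.
Proof.
move=> oU; elim: k f g => [|k IHk] f g fg [cf df].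
  split=> // p Up; apply: continuous_near_ext (cf p Up).
  exact: filterS (near_in_set oU Up).
have fg_near p : U p -> \near p, f p = g p.
  by move=> Up; apply: filterS (near_in_set oU Up).
split=> [p Up|j]; first exact: continuous_near_ext (fg_near p Up) (cf p Up).
have [dfj Cf] := df j; split=> [p Up|].
  exact: near_eq_derivable (fg_near p Up) (dfj p Up).
by apply: IHk Cf => p Up; apply: near_eq_derive; exact: fg_near.
Qed.

Lemma smooth_field_on_ext (R : realType) (n : nat) (U : set 'rV[R]_n)
    (X Y : vector_field) :
  open U -> (forall p, U p -> X p = Y p) ->
  smooth_field_on U X -> smooth_field_on U Y.
Proof.
move=> oU XY sX i k; apply: Ck_on_ext (sX i k) => // p Up.
by rewrite XY.
Qed.

Lemma smooth_on_cst (R : realType) (n : nat) (U : set 'rV[R]_n) (a : R) :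
  smooth_on U (fun=> a).
Proof.
move=> k; elim: k a => [|k IHk] a; first by split=> // p _; exact: cst_continuous.
split=> [p _|j]; first exact: cst_continuous.
split=> [p _|]; first exact: derivable_cst.
rewrite (_ : pderiv j _ = fun=> 0) //.
by apply/funext => p; apply: derive_cst.
Qed.

(** Declared as an instance so that [derive_val] computes derivatives of coordinates by
    inference. *)
#[local] Instance is_derive_coord (R : realType) (n : nat) (p v : 'rV[R]_n)
    (j : 'I_n) : is_derive p v (fun q : 'rV[R]_n => q 0 j) (v 0 j).
Proof.
have did : derivable (@id 'rV[R]_n) p v by exact: derivable_id.
split; first exact: (derivable_mxP _ _ _).1 did 0 j.
by have := derive_mx did; rewrite derive_id => /rowP/(_ j); rewrite mxE.
Qed.

Lemma smooth_on_coord (R : realType) (n : nat) (U : set 'rV[R]_n) (j : 'I_n)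
    (a : R) : smooth_on U (fun q => a * q 0 j).
Proof.
have dF p v : is_derive p v (fun q : 'rV[R]_n => a * q 0 j) (a * v 0 j).
  exact: is_deriveZ.
have cF p : {for p, continuous (fun q : 'rV[R]_n => a * q 0 j)}.
  by apply: continuousM; [exact: cst_continuous | exact: coord_continuous].
(* One differentiation already gives a constant function, so a case split on the order replaces
   induction. *)
case=> [|k]; split=> // i; split=> [p _|]; first by have [] := dF p (delta_mx 0 i).
rewrite (_ : pderiv i _ = fun=> a * (delta_mx 0 i : 'rV[R]_n) 0 j).
  exact: smooth_on_cst.
by apply/funext => p; apply: derive_val.
Qed.

Lemma smooth_field_cst (R : realType) (n : nat) (U : set 'rV[R]_n)
    (v : 'rV[R]_n) : smooth_field_on U (fun=> v).
Proof. by move=> i; exact: smooth_on_cst. Qed.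

Lemma smooth_log_frame (R : realType) (n : nat) (U : set 'rV[R]_n) (k : 'I_n) :
  smooth_field_on U (fun q => q 0 k *: delta_mx 0 k).
Proof.
move=> i; rewrite (_ : (fun _ => _) =
    fun q : 'rV[R]_n => (delta_mx 0 k : 'rV[R]_n) 0 i * q 0 k).
  exact: smooth_on_coord.
by apply/funext => q; rewrite mxE mulrC.
Qed.

(** * Christoffel symbols from the frame x_j d_j *)

(** Homogeneity in the first argument is [connection_linear] with the zero field as second summand,
    once D_0 Y = 0 is known. *)
Lemma connection_scale (R : realType) (n : nat) (U : set 'rV[R]_n)
    (D : connection U) (f : scalar_field) (X Y : vector_field) :
  smooth_on U f -> smooth_field_on U X -> smooth_field_on U Y ->
  smooth_field_on U (fun q => f q *: X q) ->
  forall p, U p -> D (fun q => f q *: X q) Y p = f p *: D X Y p.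
Proof.
move=> sf sX sY sfX p Up.
have s0 : smooth_field_on U (fun=> 0 : 'rV[R]_n) by exact: smooth_field_cst.
(* Linearity with factor 1 and two zero fields reads D_0 Y = D_0 Y + D_0 Y. *)
have D0 : D (fun=> 0) Y p = 0.
  have := connection_linear D (smooth_on_cst U 1) s0 s0 sY Up.
  rewrite (_ : (fun _ => _) = fun=> 0); last first.
    by apply/funext => q; rewrite scaler0 addr0.
  by rewrite scale1r => /eqP; rewrite -subr_eq0 opprD addNKr oppr_eq0 => /eqP.
have := connection_linear D sf sX s0 sY Up; rewrite D0 addr0 => <-.
by congr (nabla D _ Y p); apply/funext => q; rewrite addr0.
Qed.

(* The product rule in D_{x_j d_j} (x_k d_k) = 0. *)
Lemma nabla_std_frame (R : realType) (n : nat)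
    (D : connection (positive_orthant R n)) (j k : 'I_n) (p : 'rV[R]_n) :
  positive_orthant R n p ->
  D (fun q => q 0 j *: delta_mx 0 j) (fun q => q 0 k *: delta_mx 0 k) p = 0 ->
  D (fun=> delta_mx 0 j) (fun=> delta_mx 0 k) p =
    - ((j == k)%:R / p 0 k) *: delta_mx 0 k.
Proof.
move=> Up; have pn0 i : p 0 i != 0 by rewrite gt_eqF.
have scoord i : smooth_on (positive_orthant R n) (fun q : 'rV[R]_n => q 0 i).
  rewrite (_ : (fun _ => _) = fun q : 'rV[R]_n => 1 * q 0 i).
    exact: smooth_on_coord.
  by apply/funext => q; rewrite mul1r.
have sd (i : 'I_n) := smooth_field_cst (positive_orthant R n)
  (delta_mx 0 i : 'rV[R]_n).
rewrite (connection_scale D (scoord j) (sd j) (smooth_log_frame _ _)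
  (smooth_log_frame _ _) Up).
rewrite (connection_leibniz D (scoord k) (sd j) (sd k) Up).
have -> : act (fun=> delta_mx 0 j) (fun q : 'rV[R]_n => q 0 k) p = (j == k)%:R.
  rewrite /act (bigD1 j)//= big1 ?addr0 => [|i ij].
    by rewrite /pderiv derive_val !mxE !eqxx mul1r eq_sym.
  by rewrite mxE (negbTE ij) mul0r.
(* The relation is now x_j ([j = k] d_k + x_k D_{d_j} d_k) = 0; it is divided by x_j, then by
   x_k. *)
move/eqP; rewrite scaler_eq0 (negbTE (pn0 j)) /= addrC addr_eq0 => /eqP.
move/(congr1 (fun v => (p 0 k)^-1 *: v)); rewrite scalerA mulVf // scale1r => ->.
by rewrite scalerN scalerA scaleNr mulrC.
Qed.

(** * Jacobians and coordinate fields of the two charts *)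

Lemma jacobian_id (R : realType) (n : nat) (p : 'rV[R]_n) :
  'J (@id 'rV[R]_n) p = 1%:M.
Proof.
apply/row_matrixP => j.
rewrite rowE -deriveEjacobian; last exact: ex_diff.
by rewrite derive_id row1.
Qed.

Lemma coord_field_id (R : realType) (n : nat) (j : 'I_n) :
  coord_field (@id 'rV[R]_n) j = fun=> delta_mx 0 j.
Proof. by apply/funext => p; rewrite /coord_field jacobian_id invmx1 row1. Qed.

Lemma differentiable_ln_coord (R : realType) (n : nat) (p : 'rV[R]_n)
    (i : 'I_n) :
  0 < p 0 i -> differentiable (fun q : 'rV[R]_n => ln (q 0 i)) p.
Proof.
move=> pi_gt0; have dl := is_derive1_ln pi_gt0.
apply: (@differentiable_comp _ _ _ _ (fun q : 'rV[R]_n => q 0 i : R) (@ln R)).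
  exact: differentiable_coord.
exact/derivable1_diffP.
Qed.

Lemma derive_ln_coord (R : realType) (n : nat) (p v : 'rV[R]_n) (i : 'I_n) :
  0 < p 0 i ->
  'D_v (fun q : 'rV[R]_n => ln (q 0 i)) p = v 0 i * (p 0 i)^-1.
Proof.
move=> pi_gt0; have dl := is_derive1_ln pi_gt0.
have dc : differentiable (fun q : 'rV[R]_n => q 0 i : R) p.
  exact: differentiable_coord.
have dln : differentiable (@ln R) (p 0 i) by exact/derivable1_diffP.
rewrite deriveE; last exact: differentiable_ln_coord.
rewrite (diff_comp dc dln) /= diff1E // derive1E derive_val.
by rewrite -deriveE // derive_val.
Qed.

Lemma jacobian_log (R : realType) (n : nat) (p : 'rV[R]_n) :
  positive_orthant R n p ->
  'J (log_coordinates R n) p = diag_mx (\row_i (p 0 i)^-1).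
Proof.
move=> Up; have dlog : differentiable (log_coordinates R n) p.
  (* Writing the map as a sum of scalar functions times basis vectors reduces its differentiability
     to that of each log x_i. *)
  rewrite (_ : log_coordinates R n =
    \sum_(i < n) (fun q : 'rV[R]_n => ln (q 0 i) *: (delta_mx 0 i : 'rV[R]_n))).
    apply: differentiable_sum => i; apply: differentiableZl.
    exact: differentiable_ln_coord.
  apply/funext => q; rewrite fct_sumE; apply/rowP => i.
  rewrite /log_coordinates mxE summxE (bigD1 i)//= big1 ?addr0 => [|j ij].
    by rewrite !mxE !eqxx mulr1.
  by rewrite !mxE [i == j]eq_sym (negbTE ij) andbF mulr0.
apply/row_matrixP => j; rewrite rowE -deriveEjacobian //.
rewrite derive_mx; last exact: diff_derivable.
rewrite row_diag_mx; apply/rowP => i; rewrite !mxE.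
rewrite (_ : (fun _ => _) = fun q : 'rV[R]_n => ln (q 0 i)); last first.
  by apply/funext => q; rewrite mxE.
rewrite derive_ln_coord // !mxE eqxx /= mulrC.
by have [->|] := eqVneq i j; rewrite ?mulr0.
Qed.

Lemma invmx_jacobian_log (R : realType) (n : nat) (p : 'rV[R]_n) :
  positive_orthant R n p ->
  invmx ('J (log_coordinates R n) p) = diag_mx p.
Proof.
move=> Up; rewrite jacobian_log //; set A := diag_mx _.
have AV : A *m diag_mx p = 1%:M.
  rewrite mulmx_diag -diag_const_mx; congr diag_mx; apply/rowP => i.
  by rewrite !mxE mulVf // gt_eqF.
by rewrite -[RHS](mulKmx (mulmx1_unit AV).1) AV mulmx1.
Qed.

Lemma coord_field_log (R : realType) (n : nat) (j : 'I_n) (p : 'rV[R]_n) :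
  positive_orthant R n p ->
  coord_field (log_coordinates R n) j p = p 0 j *: delta_mx 0 j.
Proof.
by move=> Up; rewrite /coord_field invmx_jacobian_log // row_diag_mx.
Qed.

(** The hypothesis concerns the frame d/dt_j = x_j d_j, whereas [geodesic] is written with the
    coefficients of the standard frame; this lemma makes the passage. *)
Lemma std_coef_of_log_affine (R : realType) (n : nat)
    (D : connection (positive_orthant R n)) :
  affine_coordinates (log_coordinates R n) D ->
  forall i j k p, positive_orthant R n p ->
  connection_coef id D i j k p = - (((j == k) && (i == k))%:R / p 0 k).
Proof.
move=> aff i j k p Up.
rewrite /connection_coef !coord_field_id jacobian_id mulmx1.
rewrite nabla_std_frame //.
  rewrite !mxE eqxx /=.
  by case: (j == k); case: (i == k); rewrite ?mulr1 ?mulr0 ?mul0r ?oppr0.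
(* The formula x_l d_l for d/dt_l is available on the orthant only, so smoothness is transported
   along that equality and [connection_ext] then exchanges the fields. *)
have frame l : smooth_field_on (positive_orthant R n)
    (coord_field (log_coordinates R n) l).
  apply: (@smooth_field_on_ext _ _ _ (fun q => q 0 l *: delta_mx 0 l)).
  - exact: open_positive_orthant.
  - by move=> q Uq; rewrite coord_field_log.
  - exact: smooth_log_frame.
rewrite -(connection_ext D (frame j) (smooth_log_frame _ j) (frame k)
  (smooth_log_frame _ k) (coord_field_log j) (coord_field_log k) Up).
set v := nabla _ _ _ _.
have J_unit : 'J (log_coordinates R n) p \in unitmx.
  rewrite jacobian_log // unitmxE det_diag unitfE; apply/prodf_neq0 => l _.
  by rewrite mxE invr_eq0 gt_eqF.
(* The coefficients are the entries of [v] times the Jacobian; as the Jacobian is invertible, their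
   vanishing gives [v] = 0. *)
rewrite -[LHS](mulmxK J_unit) (_ : v *m _ = 0) ?mul0mx //.
by apply/rowP => l; rewrite [RHS]mxE; exact: aff.
Qed.

(** * Differential equations on an interval *)

(** Mean value theorem between the two points; [I] being an interval keeps the whole segment inside
    it. *)
Lemma is_derive_0_is_cst_on (R : realType) (I : set R) (f : R -> R) :
  is_interval I -> (forall s, I s -> is_derive s 1 f 0) ->
  forall s t, I s -> I t -> f s = f t.
Proof.
move=> itvI df s t; wlog st : s t / s <= t => [H Is It|Is It].
  by case: (leP s t) => [/H|/ltW /H] ->.
have I_sub x : s <= x <= t -> I x by exact: itvI Is It x.
have [x||c _ /eqP] := @MVT_segment R f (cst 0) s t st.
- by rewrite in_itv /= => /andP[sx xt]; apply/df/I_sub; rewrite !ltW.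
- apply: derivable_within_continuous => x; rewrite in_itv /= => xst.
  exact: (@ex_derive _ _ _ _ _ _ _ (df x (I_sub x xst))).
- by rewrite mul0r subr_eq0 => /eqP ->.
Qed.

Lemma is_derive_derive1 (R : realType) (f : R -> R) (s : R) :
  derivable f s 1 -> is_derive s 1 f (derive1 f s).
Proof. by move=> df; apply: DeriveDef => //; rewrite derive1E. Qed.

(** Constancy is used twice: for f', with value a, and then for f - a s. *)
Lemma derive1_constant_affine (R : realType) (I : set R) (f : R -> R) :
  is_interval I ->
  (forall s, I s -> derivable f s 1 /\ is_derive s 1 (derive1 f) 0) ->
  I !=set0 -> exists a b, forall s, I s -> f s = b + a * s.
Proof.
move=> itvI df [s0 Is0]; pose a := derive1 f s0.
have f'E s : I s -> derive1 f s = a.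
  by move=> Is; apply: is_derive_0_is_cst_on itvI _ _ _ Is Is0 => t /df[].
pose g s := f s - a * s.
have gE s : I s -> g s = g s0.
  move=> Is; apply: is_derive_0_is_cst_on itvI _ _ _ Is Is0 => t It.
  have [dft _] := df t It.
  have := f'E t It; rewrite derive1E => f't.
  have ? : is_derive t 1 f a by split.
  by apply: is_derive_eq; rewrite /GRing.scale /= mulr1 subrr.
exists a, (g s0) => s Is; by rewrite -(gE s Is) subrK.
Qed.

Lemma is_derive_expR_linear (R : realType) (a t : R) :
  is_derive t 1 (fun s => expR (a * s)) (expR (a * t) * a).
Proof.
apply: (@is_derive1_comp _ expR (fun s => a * s)).
by apply: is_derive_eq; exact: mulr1.
Qed.

(* Both f' / f =: a and f exp (- a s) are first integrals. *)
Lemma log_affine_ode (R : realType) (I : set R) (f : R -> R) :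
  is_interval I -> I !=set0 ->
  (forall s, I s -> [/\ 0 < f s, derivable f s 1, derivable (derive1 f) s 1 &
     derive1 (derive1 f) s = (derive1 f s) ^+ 2 / f s]) ->
  exists a b, 0 < b /\ forall s, I s -> f s = b * expR (a * s).
Proof.
move=> itvI [s0 Is0] df; pose a := derive1 f s0 / f s0.
have f'E s : I s -> derive1 f s = a * f s.
  move=> Is; have [fs_gt0 _ _ _] := df s Is.
  rewrite -[LHS](@divfK _ (f s)) ?gt_eqF //; congr (_ * _).
  pose q u := derive1 f u * (f u)^-1.
  apply: (@is_derive_0_is_cst_on _ I q itvI _ s s0) => // t It.
  have [ft_gt0 dft df't f''t] := df t It.
  have Df := is_derive_derive1 dft; have Ddf := is_derive_derive1 df't.
  have ft0 : f t != 0 by rewrite gt_eqF.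
  have DV := @is_deriveV _ f t _ 1 ft0 Df.
  apply: (@is_derive_eq _ _ _ _ _ _ _ _ (is_deriveM Ddf DV)).
  (* The quotient rule gives (f'/f)' = f''/f - f'^2/f^2, which the equation for f'' cancels. *)
  rewrite /GRing.scale /= f''t.
  by field.
pose g s := f s * expR (- a * s).
have gE s : I s -> g s = g s0.
  move=> Is; apply: is_derive_0_is_cst_on itvI _ _ _ Is Is0 => t It.
  have [ft_gt0 dft _ _] := df t It.
  have Df := is_derive_derive1 dft.
  apply: (@is_derive_eq _ _ _ _ _ _ _ _ (is_deriveM Df (is_derive_expR_linear (- a) t))).
  rewrite /GRing.scale /= f'E //.
  by ring.
exists a, (g s0); split=> [|s Is].
  by have [? _ _ _] := df s0 Is0; rewrite mulr_gt0 ?expR_gt0.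
by rewrite -(gE s Is) /g -mulrA -expRD mulNr addNr expR0 mulr1.
Qed.

(** * Completeness in the logarithmic structure *)

Lemma log_affine_complete (R : realType) (n : nat)
    (D : connection (positive_orthant R n)) :
  affine_coordinates (log_coordinates R n) D -> geodesically_complete D.
Proof.
move=> aff I c [[oI itvI I0 cU geo] cmax].
(* Only the term j = k = i survives. The velocity [y] is arbitrary so that the formula serves both
   the given geodesic and its extension. *)
have coef (i : 'I_n) (p : 'rV[R]_n) (y : 'I_n -> R) : positive_orthant R n p ->
    \sum_(j < n) \sum_(k < n) connection_coef id D i j k p * y j * y k =
    - ((y i) ^+ 2 / p 0 i).
  move=> Up; rewrite (bigD1 i)//= (bigD1 i)//= !big1 ?addr0.
  - by rewrite std_coef_of_log_affine // !eqxx /= mul1r; ring.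
  - move=> j ji; rewrite big1 // => k _; rewrite std_coef_of_log_affine //.
    have -> : (j == k) && (i == k) = false.
      by apply: contra_neqF ji => /andP[/eqP-> /eqP->].
    by rewrite !mul0r oppr0 !mul0r.
  - move=> k ki; rewrite std_coef_of_log_affine //.
    by rewrite [i == k]eq_sym (negbTE ki) andbF !mul0r oppr0 !mul0r.
have sol (i : 'I_n) : exists ab : R * R, 0 < ab.2 /\
    forall s, I s -> c s 0 i = ab.2 * expR (ab.1 * s).
  have [|a [b abP]] := @log_affine_ode R I (fun s => c s 0 i) itvI I0.
    move=> s Is; have [dx dx' eqn] := geo s Is i; split=> //; first exact: cU.
    by apply/eqP; rewrite -subr_eq0; apply/eqP; rewrite -eqn coef //; exact: cU.
  by exists (a, b).
(* Choice turns the constants (a_i, b_i), found one component at a time, into a function of i, from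
   which the extension [d] is assembled. *)
pose ab i := sval (cid (sol i)).
have abP i : 0 < (ab i).2 /\
    forall s, I s -> c s 0 i = (ab i).2 * expR ((ab i).1 * s).
  exact: svalP (cid (sol i)).
pose d s : 'rV[R]_n := \row_i ((ab i).2 * expR ((ab i).1 * s)).
have dE i : (fun s => d s 0 i) = fun s => (ab i).2 * expR ((ab i).1 * s).
  by apply/funext => s; rewrite mxE.
have dU s : positive_orthant R n (d s).
  by move=> i; rewrite mxE mulr_gt0 ?expR_gt0 //; case: (abP i).
have Dd i (s : R) : is_derive s 1 (fun s => d s 0 i) ((ab i).1 * d s 0 i).
  rewrite dE mxE.
  apply: (@is_derive_eq _ _ _ _ _ _ _ _
    (is_deriveZ (ab i).2 (is_derive_expR_linear (ab i).1 s))).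
  by rewrite /GRing.scale /=; ring.
have d'E i : derive1 (fun s => d s 0 i) = fun s => (ab i).1 * d s 0 i.
  by apply/funext => s; rewrite derive1E; apply: derive_val.
have Dd' i (s : R) :
    is_derive s 1 (fun s => (ab i).1 * d s 0 i) ((ab i).1 * ((ab i).1 * d s 0 i)).
  exact: (is_deriveZ (ab i).1 (Dd i s)).
(* Maximality is tested against [d], a geodesic on the whole line that agrees with [c] on [I]. *)
symmetry; apply: (cmax setT d) => //.
- split=> //; [exact: openT | by exists 0 |] => s _ i; rewrite !d'E.
  split; [by have [] := Dd i s | by have [] := Dd' i s |].
  rewrite derive1E (@derive_val _ _ _ _ _ _ _ (Dd' i s)).
  rewrite (coef i (d s) (fun j => derive1 (fun s => d s 0 j) s)) // d'E.
  (* With x = b exp (a s), the equation is a^2 x - (a x)^2 / x = 0. *)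
  by field; rewrite gt_eqF //; exact: dU.
- by move=> s Is; apply/rowP => i; rewrite mxE; case: (abP i) => _ ->.
Qed.

(** * Incompleteness in the original structure *)

(** The index [i0] records that the dimension is positive: in dimension 0 the orthant is a single
    point and every maximal geodesic is complete. *)
Lemma id_affine_incomplete (R : realType) (n : nat) (i0 : 'I_n)
    (D : connection (positive_orthant R n)) :
  affine_coordinates id D -> ~ geodesically_complete D.
Proof.
move=> aff complete.
have eqn (i : 'I_n) (p : 'rV[R]_n) (y : 'I_n -> R) : positive_orthant R n p ->
    \sum_(j < n) \sum_(k < n) connection_coef id D i j k p * y j * y k = 0.
  by move=> Up; rewrite big1 // => j _; rewrite big1 // => k _; rewrite aff ?mul0r.
pose I : set R := [set s | -1 < s].
pose c (s : R) : 'rV[R]_n := const_mx (1 + s).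
have IE : I = [set` `]-1, +oo[].
  by apply/seteqP; split=> s; rewrite /= in_itv /= andbT.
have cE i : (fun s => c s 0 i) = fun s => 1 + s.
  by apply/funext => s; rewrite mxE.
have Dc (s : R) : is_derive s 1 (fun s : R => 1 + s) 1.
  by apply: is_derive_eq; rewrite mulr1 add0r.
have c'E : derive1 (fun s : R => 1 + s) = fun=> 1.
  by apply/funext => s; rewrite derive1E; apply: derive_val.
have cU s : I s -> positive_orthant R n (c s).
  by move=> Is i; rewrite mxE -(opprK 1) addrC subr_gt0.
have geo : geodesic D I c.
  split=> //.
  - by rewrite IE; exact: interval_is_interval.
  - by exists 0; rewrite /I /= ltrN10.
  - move=> s Is i; rewrite cE c'E; split.
    + by have [] := Dc s.
    + exact: derivable_cst.
    + rewrite (eqn i (c s) (fun j => derive1 (fun s => c s 0 j) s)); last exact: cU.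
      by rewrite addr0 derive1_cst.
(* Were [c] maximal, completeness would place -1 in [I]. *)
suff /complete I_T : maximal_geodesic D I c.
  have : I (-1) by rewrite I_T.
  by rewrite /I /= ltxx.
split=> // J d [oJ itvJ J0 dU dgeo] IJ dc; apply/seteqP; split=> // s Js.
(* A single component suffices: on all of [J], the [i0]-th component of the extension has the form b
   + a s. *)
have [|a [b dE]] := @derive1_constant_affine R J (fun s => d s 0 i0) itvJ _ J0.
  move=> t Jt; have [dx dx' x''] := dgeo t Jt i0; split=> //.
  rewrite (eqn i0 (d t) (fun j => derive1 (fun s => d s 0 j) t)) in x''; last exact: dU.
  by rewrite addr0 in x''; rewrite -x''; exact: is_derive_derive1.
(* The values 1 at 0 and 2 at 1, both inherited from [c], force a = b = 1; positivity of 1 + s then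
   says that s lies in [I]. *)
have I0 : I 0 by rewrite /I /= ltrN10.
have I1 : I 1 by rewrite /I /= (lt_trans (ltrN10 R)).
have := dE _ (IJ _ I0); rewrite dc // mxE => e0.
have := dE _ (IJ _ I1); rewrite dc // mxE => e1.
have := dU s Js i0; rewrite dE // /I /=.
have -> : b = 1 by lra.
have -> : a = 1 by lra.
by move=> ?; lra.
Qed.

Theorem mainTheorem5 (R : realType) (n : nat) (n_ge1 : (1 <= n)%N)
    (D_t D_x : connection (positive_orthant R n))
    (D_t_flat : flat D_t) (D_t_torsion_free : torsion_free D_t)
    (log_affine : affine_coordinates (log_coordinates R n) D_t)
    (D_x_flat : flat D_x) (D_x_torsion_free : torsion_free D_x)
    (id_affine : affine_coordinates id D_x) :
  geodesically_complete D_t /\ ~ geodesically_complete D_x.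
Proof.
split; first exact: log_affine_complete.
exact: (id_affine_incomplete (Ordinal n_ge1)).
Qed.
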